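(* Every finite supersoluble skew brace is Lagrangian. That is, if $B$ is a finite supersoluble skew brace, then for every divisor $d$ of $|B|$ there exists a sub-skew brace of $B$ of order $d$.
   Context: A skew brace is a triple $(B,+,\cdot)$, where $B$ is a set and both $(B,+)$ and $(B,\cdot)$ are groups (neither assumed abelian) satisfying $a\cdot(b+c)=a\cdot b-a+a\cdot c$ for all $a,b,c\in B$, where $-a$ denotes the inverse of $a$ in $(B,+)$. The identity elements of the two groups coincide; this common element is denoted $0$, and $0$ also denotes the ideal $\{0\}$. The lambda map is the group homomorphism $\lambda:(B,\cdot)\to\operatorname{Aut}(B,+)$ given by $\lambda_a(b)=-a+a\cdot b$. A sub-skew brace of $B$ is a subset of $B$ which is a subgroup of both $(B,+)$ and $(B,\cdot)$. An ideal of $B$ is a sub-skew brace $I$ which is normal in both $(B,+)$ and $(B,\cdot)$ and is invariant under $\lambda_a$ for every $a\in B$; then the quotient $B/I$ is again a skew brace. A finite skew brace $B$ is supersoluble if it has a series of ideals of $B$, $0=B_0\leq B_1\leq\cdots\leq B_n=B$, such that $|B_i/B_{i-1}|$ is a prime number for every $i=1,\ldots,n$. A finite skew brace $B$ is Lagrangian if, for every divisor $d$ of $|B|$, there exists a sub-skew brace of $B$ of order $d$. *)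

(* Defs.v *)
From HB Require Import structures.
From mathcomp Require Import all_boot all_fingroup.

Set Implicit Arguments.
Unset Strict Implicit.
Unset Printing Implicit Defensive.

Local Open Scope group_scope.

(* The multiplicative group (B, .) is the groupType structure of B; the additive
   group (B, +) is carried by dedicated operations, since zmodType would force
   + to be commutative. *)
HB.mixin Record Group_isSkewBrace B of monoid.Group B := {
  brace_add : B -> B -> B;
  brace_zero : B;
  brace_opp : B -> B;
  brace_addA : associative brace_add;
  brace_add0 : left_id brace_zero brace_add;
  brace_addN : left_inverse brace_zero brace_opp brace_add;
  brace_mulD : forall a b c : B,
    a * brace_add b c = brace_add (brace_add (a * b) (brace_opp a)) (a * c)
}.

#[short(type="skewBraceType")]
HB.structure Definition SkewBrace :=
  { B of Group_isSkewBrace B & monoid.Group B }.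

#[short(type="finSkewBraceType")]
HB.structure Definition FinSkewBrace := { B of SkewBrace B & Finite B }.

Definition lambda (B : skewBraceType) (a b : B) : B :=
  brace_add (brace_opp a) (a * b).

(* An alias of B whose multiplicative group is (B, +), so that the subgroup and
   normality notions of fingroup apply to the additive group as well. *)
Definition addgroup (B : Type) : Type := B.

HB.instance Definition _ (B : finSkewBraceType) := Finite.copy (addgroup B) B.
HB.instance Definition _ (B : finSkewBraceType) :=
  Finite_isGroup.Build (addgroup B)
    (@brace_addA B) (@brace_add0 B) (@brace_addN B).

Section SubSkewBraces.
Variable B : finSkewBraceType.
Implicit Types A I : {set B}.

Definition addset A : {set addgroup B} := A.

Definition sub_skew_brace A : bool := group_set A && group_set (addset A).

Definition ideal I : bool :=
  [&& sub_skew_brace I,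
      I <| [set: B],
      addset I <| [set: addgroup B] &
      [forall a : B, forall b in I, lambda a b \in I]].

End SubSkewBraces.

(* The cosets of an ideal are the same in both groups, because
   a * x = a + lambda a x; hence the quotient of the multiplicative groups has
   the underlying set of the quotient skew brace. *)
Definition supersoluble (B : finSkewBraceType) : Prop :=
  exists (n : nat) (I : nat -> {set B}),
    [/\ I 0 = [set brace_zero],
        I n = [set: B],
        forall i, i <= n -> ideal (I i) &
        forall i, i < n -> I i \subset I i.+1 /\ prime #|I i.+1 / I i| ].

Definition lagrangian (B : finSkewBraceType) : Prop :=
  forall d : nat, d %| #|B| ->
    exists A : {set B}, sub_skew_brace A /\ #|A| = d.

(* Main.v *)
Require Import Defs.
From mathcomp Require Import all_boot all_fingroup all_solvable.
Set Implicit Arguments. Unset Strict Implicit. Unset Printing Implicit Defensive.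
Local Open Scope group_scope.

(** A sub-skew brace of a supersoluble skew brace B whose order is divisible by
    a prime q contains another of index q ([sub_skew_brace_index_prime]).
    Given d dividing |B|, starting from B and removing one prime factor of |B|/d
    at a time leads to a sub-skew brace of order d.

    To find index q in A, intersect the given series with A. Its factors have
    order 1 or a prime, and at the last place where the factor has order q, the
    lower term J satisfies that |A/J| is q times a number prime to q. So it
    suffices to find a sub-skew brace D containing J with D/J of order |A/J| over
    q. This is a Hall theorem for skew braces whose two groups are solvable
    ([sub_skew_brace_Hall_over]), valid for every set pi of primes and every
    ideal J of A.

    For the Hall theorem, let the additive translations t_a : x -> a + x and the
    multiplicative ones m_a : x -> a * x, for a in A, act on B. Since m_a
    normalises the group T of additive translations, T together with the group M
    of multiplicative ones generates a solvable group G = T M. Let L be the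
    stabiliser of the set J in G. As a * J = a + J, both T and M are transitive
    on the cosets of J, that is, L T = L M = G. Hall's theorems in G give a Hall
    pi-subgroup C meeting each of L, M and T in a Hall pi-subgroup
    ([Hall_exists_setI2]). The C-orbit of J then has |A/J|_pi elements, just as
    many as the orbits of J under C :&: T and C :&: M, so that the three orbits
    coincide ([Hall_setI_mul]). The union D of this orbit is a union of cosets
    of J by a subgroup of the additive group and also by a subgroup of the
    multiplicative group, hence a sub-skew brace. Everything takes place in G,
    without forming a quotient skew brace. *)

(** * Hall subgroups and factorisations *)

Section HallFactorization.
Variables (gT : finGroupType) (pi : nat_pred).
Implicit Types G L X M K C : {group gT}.

Lemma Hall_setI_sub X K C :
  pi.-Hall(X) K -> pi.-group C -> K \subset C -> pi.-Hall(X) (C :&: X).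
Proof.
move=> hK piC sKC; have sKX := pHall_sub hK.
have -> // : C :&: X = K.
apply: sub_pHall hK (pgroupS (subsetIl C X) piC) _ _; last exact: subsetIr.
by rewrite subsetI sKC.
Qed.

(** A Hall subgroup C may be taken to contain a Hall subgroup of L, and some
    conjugate C :^ (l * m) contains one of M; since m normalises M, already
    C :^ l meets M in a Hall subgroup, and l normalises L. *)
Lemma Hall_exists_setI2 G L M :
    solvable G -> L \subset G -> M \subset G -> L * M = G ->
  exists C : {group gT},
    [/\ pi.-Hall(G) C, pi.-Hall(L) (C :&: L) & pi.-Hall(M) (C :&: M)].
Proof.
move=> solG sLG sMG defG.
have [P hP] := Hall_exists pi (solvableS sLG solG).
have [Q hQ] := Hall_exists pi (solvableS sMG solG).
have [C hC sPC] := Hall_superset solG (subset_trans (pHall_sub hP) sLG) (pHall_pgroup hP).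
have [g Gg sQC] := Hall_subJ solG hC (subset_trans (pHall_sub hQ) sMG) (pHall_pgroup hQ).
have /imset2P [l m Ll Mm eg] : g \in L * M by rewrite defG.
exists (C :^ l)%G; split.
- by rewrite pHallJ // (subsetP sLG).
- have hPl : pi.-Hall(L) (P :^ l) by rewrite pHallJ.
  by apply: Hall_setI_sub hPl _ _; rewrite ?pgroupJ ?(pHall_pgroup hC) ?conjSg.
have hQm : pi.-Hall(M) (Q :^ m^-1) by rewrite pHallJ // groupV.
apply: Hall_setI_sub hQm _ _; first by rewrite pgroupJ (pHall_pgroup hC).
by rewrite sub_conjgV -conjsgM -eg.
Qed.

(** In terms of the action of G on the cosets of L: an orbit under C is already an
    orbit under C :&: X, because both have the pi-part of |G : L| as their
    cardinal. When L :&: X is normal in X, the right-hand side is a group. *)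
Lemma Hall_setI_mul G L X C :
    L \subset G -> X \subset G -> L * X = G -> L :&: X <| X ->
    pi.-Hall(G) C -> pi.-Hall(L) (C :&: L) -> pi.-Hall(X) (C :&: X) ->
  X :&: L * C = (L :&: X) * (C :&: X)
  /\ #|X :&: L * C| = (#|L :&: X| * #|X : L :&: X|`_pi)%N.
Proof.
move=> sLG sXG defG nLX hC hCL hCX.
have hCLX : pi.-Hall(L :&: X) (C :&: X :&: (L :&: X)) by exact: Hall_setI_normal nLX hCX.
have eLX : C :&: X :&: (L :&: X) = L :&: (C :&: X).
  by rewrite -setIA [X :&: _]setIC -(setIA L) setIid setICA.
have eC : L * (C :&: X) = L * C.
  apply/eqP; rewrite eqEcard mulgS ?subsetIl //=.
  rewrite -(leq_pmul2r (cardG_gt0 (L :&: C))) -mul_cardG.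
  rewrite -(leq_pmul2r (cardG_gt0 (L :&: (C :&: X)))).
  rewrite [leqRHS]mulnAC -mul_cardG /= -eLX.
  rewrite (card_Hall hCX) (card_Hall hCLX) [L :&: C]setIC.
  rewrite (card_Hall hC) (card_Hall hCL).
  rewrite -!mulnA leq_mul2l -!partnM ?cardG_gt0 //.
  by rewrite [(#|X| * _)%N]mulnC (mul_cardG L X) defG leqnn orbT.
have e : X :&: L * C = (L :&: X) * (C :&: X).
  by rewrite -eC -group_modr ?subsetIr // setIC.
split=> //; rewrite e.
apply/eqP; rewrite -(eqn_pmul2r (cardG_gt0 (L :&: (C :&: X)))).
rewrite /=; have -> : L :&: (C :&: X) = (L :&: X) :&: (C :&: X) by rewrite -eLX setIC.
rewrite -mul_cardG -mulnA eqn_pmul2l ?cardG_gt0 //.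
rewrite [_ :&: (C :&: X)]setIC (card_Hall hCX) (card_Hall hCLX).
by rewrite -partnM ?cardG_gt0 // mulnC Lagrange // subsetIr.
Qed.
End HallFactorization.

(** * Translations *)

Section LeftTranslation.
Variable gT : finGroupType.

(** Permutations compose from left to right, so a morphism to {perm gT} requires
    the inverse. *)
Definition ltrans (a : gT) : {perm gT} := perm (mulgI a^-1).

Lemma ltransE a x : ltrans a x = a^-1 * x. Proof. by rewrite permE. Qed.

Lemma ltransM : {in [set: gT] &, {morph ltrans : a b / a * b}}.
Proof. by move=> a b _ _; apply/permP => x; rewrite permM !ltransE invMg mulgA. Qed.

Canonical ltrans_morphism := Morphism ltransM.

Lemma ltrans_inj : 'injm ltrans.
Proof.
apply/injmP => a b _ _ /permP /(_ 1).
by rewrite !ltransE !mulg1 => /invg_inj.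
Qed.

Lemma ltrans_stab (A J : {group gT}) : J \subset A ->
  'N(J | 'P) :&: ltrans @* A = ltrans @* J.
Proof.
move=> sJA; apply/setP=> g; apply/setIP/idP => [[nJg /morphimP [a _ Aa eg]]|].
  rewrite eg mem_morphim ?inE //.
  by have := astabs_act 1 nJg; rewrite group1 /= /aperm eg ltransE mulg1 groupV.
case/morphimP=> a _ Ja ->; split; last by rewrite mem_morphim ?inE ?(subsetP sJA).
rewrite !inE /=; apply/subsetP => x Jx.
by rewrite inE /= /aperm ltransE groupM ?groupV.
Qed.
End LeftTranslation.

Section AdditiveTranslation.
Variable B : finSkewBraceType.

(** The values are taken in {perm B}, rather than in the convertible type
    {perm addgroup B}, so that additive and multiplicative translations can be
    multiplied. *)
Definition ladd (a : addgroup B) : {perm B} := @ltrans (addgroup B) a.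

Lemma laddE (a x : B) : ladd a x = brace_add (brace_opp a) x.
Proof. exact: (@ltransE (addgroup B)). Qed.

Lemma laddM : {in [set: addgroup B] &, {morph ladd : a b / a * b}}.
Proof. exact: (@ltransM (addgroup B)). Qed.

Canonical ladd_morphism := Morphism laddM.

Lemma ladd_inj : 'injm ladd.
Proof. exact: (@ltrans_inj (addgroup B)). Qed.

Lemma ladd_stab (A J : {group addgroup B}) : J \subset A ->
  'N((J : {set B}) | 'P) :&: ladd @* A = ladd @* J.
Proof. exact: (@ltrans_stab (addgroup B)). Qed.
End AdditiveTranslation.

(** * A Hall theorem for skew braces *)

(** Seen in the quotient of A by J, this is the existence of a Hall pi-sub-skew
    brace. Here D consists of the a in A whose translations lie in L * C, where
    L is the stabiliser of J and C a well-chosen Hall pi-subgroup of the group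
    generated by the translations. *)
Lemma sub_skew_brace_Hall_over (B : finSkewBraceType) (pi : nat_pred)
    (A J : {set B}) :
    sub_skew_brace A -> sub_skew_brace J ->
    J <| A -> addset J <| addset A ->
    (forall a b, a \in A -> b \in J -> lambda a b \in J) ->
    solvable A -> solvable (addset A) ->
  exists D : {set B},
    [/\ sub_skew_brace D, D \subset A & #|D| = (#|J| * (#|A| %/ #|J|)`_pi)%N].
Proof.
case/andP=> gA gA' /andP[gJ gJ'] nJA nJA' lamJ solA solA'.
pose MA := Group gA; pose TA := Group gA'.
pose MJ := Group gJ; pose TJ := Group gJ'.
pose M : {group {perm B}} := (@ltrans B @* MA)%G.
pose T : {group {perm B}} := (@ladd B @* TA)%G.
have addA x y : x \in A -> y \in A -> brace_add x y \in A by exact: (@groupM _ TA).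
have oppA x : x \in A -> brace_opp x \in A by exact: (@groupVr _ TA).
have nTM : M \subset 'N(T).
  apply/subsetP=> _ /morphimP [a _ Aa ->]; rewrite inE.
  apply/subsetP=> _ /imsetP [_ /morphimP [b _ Ab ->] ->].
  pose u := a^-1; pose c : B := brace_opp b.
  have Ad : brace_add (u * c) (brace_opp u) \in A.
    by rewrite addA ?oppA // ?[u * c \in A](@groupM _ MA) ?(@groupV _ MA) ?oppA.
  (* u * (c + x) = (u * c - u) + u * x, so conjugating the translation by c
     gives the translation by u * c - u. *)
  suff -> : ladd b ^ ltrans a =
      @ladd B (brace_opp (brace_add (u * c) (brace_opp u))).
    by rewrite mem_morphim ?inE //; exact: oppA.
  apply/permP=> x; rewrite conjgE !permM ltransE.
  rewrite [RHS]laddE [brace_opp (brace_opp _)](@invgK (addgroup B)).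
  rewrite -(morphV (ltrans_morphism B)) ?inE // laddE !ltransE invgK.
  by rewrite brace_mulD mulKg.
have [G defG] : exists G : {group {perm B}}, T * M = G.
  by exists (T <*> M)%G; exact/esym/norm_joinEr.
have sTG : T \subset G by rewrite -defG mulG_subl.
have sMG : M \subset G by rewrite -defG mulG_subr.
have nTG : T <| G by rewrite /normal sTG -defG mul_subG ?normG.
have solG : solvable G.
  rewrite (series_sol nTG); apply/andP; split; first exact: morphim_sol.
  by rewrite -defG quotientMidl; exact/(quotient_sol T)/morphim_sol.
pose L := 'N_G(J | 'P)%G.
have sLG : L \subset G by exact: subsetIl.
(* l b is the map lambda b, which preserves J and relates the two translations
   by b. *)
pose l (b : B) : {perm B} := (ltrans b)^-1 * @ladd B b.
have Ll b : b \in A -> l b \in L.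
  move=> Ab; have Gm : ltrans b \in G by rewrite (subsetP sMG) ?mem_morphim ?inE.
  have Gt : @ladd B b \in G by rewrite (subsetP sTG) ?mem_morphim ?inE.
  rewrite inE groupM ?groupV ?inE //=.
  apply/subsetP=> x Jx; rewrite inE /= /aperm permM.
  rewrite -(morphV (ltrans_morphism B)) ?inE // laddE ltransE invgK.
  exact: lamJ.
have sTLM : T \subset L * M.
  apply/subsetP=> t; rewrite -groupV => /morphimP[b _ Ab et].
  have -> : t = (l b)^-1 * (@ltrans B b)^-1.
    by rewrite /l -et !invMg !invgK mulgK.
  by rewrite mem_mulg ?groupV ?Ll ?mem_morphim ?inE.
have sMLT : M \subset L * T.
  apply/subsetP=> m; rewrite -groupV => /morphimP[b _ Ab em].
  have -> : m = l b * (@ladd B b)^-1 by rewrite /l mulgK -em invgK.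
  by rewrite mem_mulg ?groupV ?Ll ?mem_morphim ?inE.
have LMG : L * M = G.
  apply/eqP; rewrite eqEsubset mul_subG //= -{1}defG.
  by rewrite (subset_trans (mulSg M sTLM)) // -mulgA mulGid.
have LTG : L * T = G.
  apply/eqP; rewrite eqEsubset mul_subG //= -{1}defG -(normC nTM).
  by rewrite (subset_trans (mulSg T sMLT)) // -mulgA mulGid.
have LM : L :&: M = @ltrans B @* MJ.
  by rewrite -(@ltrans_stab _ MA MJ (normal_sub nJA)) setIAC (setIidPr sMG) setIC.
have LT : L :&: T = @ladd B @* TJ.
  by rewrite -(@ladd_stab _ TA TJ (normal_sub nJA')) setIAC (setIidPr sTG) setIC.
have nLM : L :&: M <| M by rewrite LM morphim_normal.
have nLT : L :&: T <| T by rewrite LT morphim_normal.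
have [C [hC hCL hCM]] := Hall_exists_setI2 pi solG sLG sMG LMG.
have hCT : pi.-Hall(T) (C :&: T) by exact: Hall_setI_normal nTG hC.
have [eM cM] := Hall_setI_mul sLG sMG LMG nLM hC hCL hCM.
have [eT cT] := Hall_setI_mul sLG sTG LTG nLT hC hCL hCT.
have [XM eXM] : exists X : {group {perm B}}, X :=: M :&: L * C.
  exists ((L :&: M) <*> (C :&: M))%G.
  by rewrite eM; apply/norm_joinEr/(subset_trans (subsetIr C M))/normal_norm.
have [XT eXT] : exists X : {group {perm B}}, X :=: T :&: L * C.
  exists ((L :&: T) <*> (C :&: T))%G.
  by rewrite eT; apply/norm_joinEr/(subset_trans (subsetIr C T))/normal_norm.
have LLC g h : g \in L -> h \in L * C -> g * h \in L * C.
  by move=> Lg LCh; rewrite -(mulGid L) -mulgA mem_mulg.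
have inMA (a : B) : ltrans a \in M -> a \in A.
  by case/morphimP=> b _ Ab /(injmP (ltrans_inj B)) -> //; rewrite inE.
have inTA (a : B) : @ladd B a \in T -> a \in A.
  by case/morphimP=> b _ Ab /(injmP (ladd_inj B)) -> //; rewrite inE.
(* The translations by a differ by an element of L, so that they lie in the
   same coset of L and belong together to L * C or not. *)
have eD : @ltrans B @*^-1 XM = @ladd B @*^-1 XT.
  apply/setP=> a; apply/morphpreP/morphpreP=> -[_ Xa]; split; rewrite ?inE //.
    rewrite -groupV; move: Xa; rewrite -groupV eXM eXT => /setIP[Ma LCa].
    have Aa : a \in A by apply: inMA; rewrite -groupV.
    rewrite inE groupV mem_morphim ?inE //=.
    have -> : (@ladd B a)^-1 = (l a)^-1 * (@ltrans B a)^-1.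
      by rewrite /l !invMg !invgK mulgK.
    by rewrite LLC // groupV Ll.
  rewrite -groupV; move: Xa; rewrite -groupV eXM eXT => /setIP[Ta LCa].
  have Aa : a \in A by apply: inTA; rewrite -groupV.
  rewrite inE groupV mem_morphim ?inE //=.
  have -> : (@ltrans B a)^-1 = l a * (@ladd B a)^-1 by rewrite /l mulgK.
  by rewrite LLC // Ll.
have sXM : XM \subset M by rewrite eXM subsetIl.
exists (@ltrans B @*^-1 XM); split.
- by rewrite /sub_skew_brace groupP; rewrite /addset eD; exact: (groupP (@ladd B @*^-1 XT)%G).
- by apply/subsetP=> a /morphpreP[_ Xa]; apply/inMA/(subsetP sXM).
rewrite -(card_injm (ltrans_inj B)) ?subsetT // morphpreK; last first.
  by apply: subset_trans sXM (morphimS _ (subsetT _)).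
rewrite eXM cM -divgS ?subsetIr //= LM.
by rewrite !(card_injm (ltrans_inj B)) ?subsetT.
Qed.

(** * Supersoluble skew braces *)

Lemma prime_series_sol (gT : finGroupType) (n : nat) (I : nat -> {set gT}) :
    #|I 0| = 1%N ->
    (forall i, i <= n -> group_set (I i) /\ I i <| [set: gT]) ->
    (forall i, i < n -> I i \subset I i.+1 /\ prime (#|I i.+1| %/ #|I i|)) ->
  solvable (I n).
Proof.
elim: n => [|n IHn] I0 nI prI.
  have [gI _] := nI 0 isT.
  by have -> : I 0 = 1; [exact: (card1_trivg (G := Group gI)) | exact: solvable1].
have [gS _] := nI n.+1 (leqnn _); have [g0 n0] := nI n (leqnSn _).
have [sI prn] := prI n (leqnn _).
have nIn : Group g0 <| Group gS by rewrite /normal sI (subset_trans (subsetT _) (normal_norm n0)).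
rewrite -[I n.+1]/(gval (Group gS)) (series_sol nIn); apply/andP; split.
  by apply: IHn => // i lt_in; [apply/nI/leqW | apply/prI/leqW].
apply/abelian_sol/cyclic_abelian/prime_cyclic.
by rewrite (card_quotient (normal_norm nIn)) -divgS ?normal_sub.
Qed.

Section Supersoluble.
Variables (B : finSkewBraceType) (n : nat) (I : nat -> {set B}).
Hypotheses (I0 : #|I 0| = 1%N) (In : I n = [set: B]).
Hypothesis idI : forall i, i <= n -> ideal (I i).
Hypothesis prI :
  forall i, i < n -> I i \subset I i.+1 /\ prime (#|I i.+1| %/ #|I i|).

(** The required D lies over J = A :&: I m for the largest m such that |A : J|
    is divisible by q: then the q-part of |A : J| is exactly q, and D is a Hall
    q'-subgroup of A modulo J. *)
Lemma sub_skew_brace_index_prime (A : {set B}) (q : nat) :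
    sub_skew_brace A -> prime q -> q %| #|A| ->
  exists D : {set B}, sub_skew_brace D /\ (#|D| * q)%N = #|A|.
Proof.
move=> bA pr_q q_dv_A; have [gA gA'] := andP bA.
have A_gt0 : 0 < #|A| := cardG_gt0 (Group gA).
have solA : solvable A.
  apply: (solvableS (H := Group gA) (G := [set: B]%G)); first exact: subsetT.
  rewrite /= -In; apply: prime_series_sol => // i /idI /and4P[/andP[gI _] nI _ _].
  by split.
have solA' : solvable (addset A).
  apply: (solvableS (H := Group gA') (G := [set: addgroup B]%G)); first exact: subsetT.
  suff: solvable (addset (I n)) by rewrite In.
  apply: (@prime_series_sol (addgroup B) n (fun i => addset (I i))) => // i.
  by move=> /idI /and4P[/andP[_ gI] _ nI _]; split.
pose c i := #|A :&: I i|.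
have c_gt0 i : i <= n -> 0 < c i.
  by move=> /idI /and4P[/andP[gI _] _ _ _]; exact: (cardG_gt0 (Group gA :&: Group gI)%G).
pose P i := logn q (c i) == logn q #|A|.
have Pn : exists i, P i by exists n; rewrite /P /c In setIT.
have vA : 0 < logn q #|A| by rewrite logn_gt0 mem_primes pr_q A_gt0.
(* At the least such index m.+1 > 0, passing from A :&: I m to A :&: I m.+1
   completes the q-part of |A|, so this step has order exactly q. *)
case: (ex_minnP Pn) => [[|m]] Pm minm.
  have c0 : c 0 = 1%N.
    apply/eqP; rewrite eqn_leq c_gt0 // andbT -I0.
    by apply: subset_leq_card; exact: subsetIr.
  by move: Pm vA; rewrite /P c0 logn1 => /eqP <-.
have lt_mn : m < n by apply: minm; rewrite /P /c In setIT.
have [sI prS] := prI lt_mn.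
have /and4P[bI nI nI' /forallP lamI] := idI (ltnW lt_mn).
have /and4P[/andP[gS _] _ _ _] := idI lt_mn.
have [gI gI'] := andP bI.
have dvA : c m %| #|A| := cardSg (subsetIl (Group gA) (Group gI)).
have cS : (c m.+1 = c m * #|Group gA :&: Group gS : Group gI|)%N.
  rewrite /c -(LagrangeI (Group gA :&: Group gS)%G (Group gI)) /=.
  by rewrite -setIA (setIidPr sI).
set k := #|_ : _| in cS.
have k_dv : k %| #|I m.+1| %/ #|I m|.
  have nS : Group gS \subset 'N(Group gI) by exact: subset_trans (subsetT _) (normal_norm nI).
  rewrite (divgS (G := Group gS) (H := Group gI) sI) -(card_quotient nS).
  rewrite /k -(card_quotient (subset_trans (subsetIr _ _) nS)).
  by apply: cardSg; apply: quotientS; exact: subsetIr.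
have k_gt0 : 0 < k by exact: indexg_gt0.
have lt_c : logn q (c m) < logn q #|A|.
  rewrite ltn_neqAle (dvdn_leq_log _ A_gt0 dvA) andbT.
  by apply/negP=> /minm; rewrite ltnn.
have ek : k = q.
  have vk : 0 < logn q k.
    move: Pm lt_c; rewrite /P cS lognM ?c_gt0 ?(ltnW lt_mn) // => /eqP <-.
    by rewrite -[ltnLHS]addn0 ltn_add2l.
  have q_dv : q %| k by move: vk; rewrite logn_gt0 mem_primes => /and3P[].
  move: k_dv q_dv (prS) => /(primeP prS).2 /orP[] /eqP->; first by rewrite Euclid_dvd1.
  by rewrite dvdn_prime2 // => /eqP.
have bJ : sub_skew_brace (A :&: I m).
  apply/andP; split; first exact: (groupP (Group gA :&: Group gI)%G).
  exact: (groupP (Group gA' :&: Group gI')%G).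
have nJ : A :&: I m <| A.
  rewrite /normal subsetIl normsI ?(normG (Group gA)) //.
  exact: subset_trans (subsetT _) (normal_norm nI).
have nJ' : addset (A :&: I m) <| addset A.
  have -> : addset (A :&: I m) = addset A :&: addset (I m) by [].
  rewrite /normal subsetIl normsI ?(normG (Group gA')) //.
  exact: subset_trans (subsetT _) (normal_norm nI').
have lamJ a b : a \in A -> b \in A :&: I m -> lambda a b \in A :&: I m.
  move=> Aa /setIP[Ab Ib]; rewrite inE (implyP (forallP (lamI a) b) Ib) andbT.
  have Aab : a * b \in A by exact: (@groupM _ (Group gA)).
  by apply: (@groupM _ (Group gA')) => //; exact: (@groupVr _ (Group gA')).
have [D [bD _ cD]] := sub_skew_brace_Hall_over q^' bA bJ nJ nJ' lamJ solA solA'.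
exists D; split=> //; rewrite cD -/(c m).
have q1 : logn q (#|A| %/ c m) = 1%N.
  rewrite logn_div // -(eqP Pm) cS ek lognM ?c_gt0 ?(ltnW lt_mn) ?prime_gt0 //.
  by rewrite addKn logn_prime // eqxx.
have quo_gt0 : 0 < #|A| %/ c m 
  by rewrite (divn_gt0 _ (c_gt0 m (ltnW lt_mn))) (dvdn_leq A_gt0 dvA).
rewrite -{2}(divnK dvA) -{2}(partnC q quo_gt0) p_part q1 expn1.
by rewrite [RHS]mulnC -mulnA [(_ * q)%N]mulnC.
Qed.

Lemma sub_skew_brace_lagrange (A : {set B}) (d : nat) :
  sub_skew_brace A -> d %| #|A| ->
  exists D : {set B}, sub_skew_brace D /\ #|D| = d.
Proof.
have [k] := ubnP #|A|; elim: k => // k IHk in A *; rewrite ltnS => leAk bA d_dv.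
have A_gt0 : 0 < #|A| := cardG_gt0 (Group (proj1 (andP bA))).
have e : (#|A| %/ d * d)%N = #|A| := divnK d_dv.
have [q1|] := eqVneq (#|A| %/ d) 1%N; first by exists A; rewrite -e q1 mul1n.
move=> quo1.
have quo_gt0 : 0 < #|A| %/ d.
  by rewrite divn_gt0 ?(dvdn_gt0 A_gt0 d_dv) // (dvdn_leq A_gt0 d_dv).
have quo_gt1 : 1 < #|A| %/ d by rewrite ltn_neqAle eq_sym quo1 quo_gt0.
have pr_q := pdiv_prime quo_gt1; have q_dv := pdiv_dvd (#|A| %/ d).
move: (pdiv _) pr_q q_dv => q pr_q q_dv.
have q_dvA : q %| #|A| by rewrite (dvdn_trans q_dv) // dvdn_div.
have [D [bD cD]] := sub_skew_brace_index_prime bA pr_q q_dvA.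
have D_gt0 : 0 < #|D| := cardG_gt0 (Group (proj1 (andP bD))).
apply: (IHk D) bD _.
  by apply: leq_trans leAk; rewrite -cD ltn_Pmulr ?prime_gt1.
by rewrite -(dvdn_pmul2r (prime_gt0 pr_q)) cD -e mulnC dvdn_mul.
Qed.
End Supersoluble.

Theorem corollary3p3 (B : finSkewBraceType) : supersoluble B -> lagrangian B.
Proof.
case=> n [I [I0 In idI prI]] d d_dv.
have prI' i : i < n -> I i \subset I i.+1 /\ prime (#|I i.+1| %/ #|I i|).
  move=> lt_in; have [sI prQ] := prI i lt_in; split=> //.
  have /and4P[/andP[gI _] nI _ _] := idI i (ltnW lt_in).
  have /and4P[/andP[gS _] _ _ _] := idI i.+1 lt_in.
  rewrite (divgS (G := Group gS) (H := Group gI) sI) -card_quotient //.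
  exact: subset_trans (subsetT _) (normal_norm nI).
apply: (@sub_skew_brace_lagrange B n I _ In idI prI' [set: B]).
- by rewrite I0 cards1.
- by rewrite -In; have /and4P[] := idI n (leqnn n).
- by rewrite cardsT.
Qed.
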